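(* Let $A$ be a unital subring of $\mathbb{R}$. Then $H(A)_{p}$ is skew-amenable.
   Context: For a topological group $G$ and $g\in G$ let $\lambda_g\colon G\to G,\ x\mapsto gx$. $\mathrm{LUCB}(G)$ is the algebra of bounded functions $f\colon G\to\mathbb{R}$ that are left-uniformly continuous, i.e., for every $\epsilon>0$ there is a neighborhood $U$ of the neutral element with $|f(x)-f(y)|\le\epsilon$ whenever $x^{-1}y\in U$. A mean on $\mathrm{LUCB}(G)$ is a positive linear functional $\mu$ with $\mu(\mathbf 1)=1$. $G$ is skew-amenable if $\mathrm{LUCB}(G)$ admits a mean $\mu$ with $\mu(f\circ\lambda_g)=\mu(f)$ for all $f\in\mathrm{LUCB}(G)$, $g\in G$. Monod's groups. Let $\mathbf{P}^1=\mathbf{P}^1(\mathbb{R})$ be the real projective line with its projective topology (the quotient topology inherited from the unit circle $S^1\subseteq\mathbb{R}^2$), and let $\infty=[1:0]$. For a unital subring $A\subseteq\mathbb{R}$, the group $\mathrm{PSL}(2,A)=\mathrm{SL}(2,A)/\{\pm E_2\}$ ($E_2$ the identity matrix) acts faithfully by homeomorphisms on $\mathbf{P}^1$. Let $P_A$ be the set of all points of $\mathbf{P}^1$ fixed by some hyperbolic element of $\mathrm{PSL}(2,A)$ (an element is hyperbolic if its trace has absolute value $>2$). $H(A)$ is the group of all homeomorphisms of $\mathbf{P}^1$ which fix $\infty$ and are piecewise in $\mathrm{PSL}(2,A)$, with finitely many pieces, each piece being an interval in the cyclic order of $\mathbf{P}^1$ with endpoints in $P_A$. $H(A)_p$ denotes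 $H(A)$ with the topology of pointwise convergence arising from the discrete topology on $\mathbf{P}^1$ (pointwise stabilizers of finite subsets of $\mathbf{P}^1$ form a neighborhood basis of the identity). *)

(* Defs.v *)
From HB Require Import structures.
From mathcomp Require Import all_boot all_order all_algebra.
From mathcomp Require Import generic_quotient.
From mathcomp Require Import ring lra.
From mathcomp Require Import all_classical all_reals all_analysis.
Import numFieldNormedType.Exports.

Set Implicit Arguments.
Unset Strict Implicit.
Unset Printing Implicit Defensive.

Import Order.TTheory GRing.Theory Num.Theory.

Local Open Scope classical_set_scope.
Local Open Scope ring_scope.

HB.mixin Record isTopologicalGroup G & Topological G & Group G := {
  mulg_continuous : continuous (fun x : G * G => (x.1 * x.2)%g) ;
  invg_continuous : continuous (fun x : G => (x^-1)%g)
}.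

#[short(type="topologicalGroupType")]
HB.structure Definition TopologicalGroup :=
  {G of Topological G & Group G & isTopologicalGroup G}.

Section LUCB.
Variables (R : realType) (G : topologicalGroupType).

Definition left_uniformly_continuous (f : G -> R) : Prop :=
  forall e : R, 0 < e -> exists2 U : set G, nbhs 1%g U &
    forall x y : G, U (x^-1 * y)%g -> `|f x - f y| <= e.

Definition lucb : {pred G -> R^o} := [pred f : G -> R^o |
  `[< (exists M : R, forall x, `|f x| <= M) /\ left_uniformly_continuous f >]].

Lemma lucbP (f : G -> R^o) :
  reflect ((exists M : R, forall x, `|f x| <= M) /\ left_uniformly_continuous f)
          (f \in lucb).
Proof. exact: asboolP. Qed.

Lemma lucb_submod_closed : submod_closed lucb.
Proof.
split=> [|a f g /lucbP[[M fM] uf] /lucbP[[N gN] ug]]; apply/lucbP; split.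
- by exists 0 => x; rewrite normr0.
- move=> e e0; exists setT => [|x y _]; first exact: filterT.
  by rewrite subrr normr0 ltW.
- exists (`|a| * M + N) => x; rewrite (le_trans (ler_normD _ _))//.
  by rewrite lerD// normrM ler_wpM2l.
- move=> e e0.
  have a1 : 0 < `|a| + 1 by rewrite ltr_wpDl.
  have [U U1 fU] := uf (e / 2 / (`|a| + 1)) ltac:(by rewrite !divr_gt0).
  have [V V1 gV] := ug (e / 2) ltac:(by rewrite divr_gt0).
  exists (U `&` V); first exact: filterI.
  move=> x y [/fU fxy /gV gxy].
  rewrite (_ : _ - _ = a * (f x - f y) + (g x - g y)); last first.
    by rewrite !fctE /GRing.scale/=; ring.
  rewrite (le_trans (ler_normD _ _))// [e]splitr lerD// normrM.
  rewrite (@le_trans _ _ ((`|a| + 1) * `|f x - f y|))//.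
    by rewrite ler_wpM2r// lerDl.
  by rewrite mulrC -ler_pdivlMr.
Qed.

HB.instance Definition _ :=
  GRing.isSubmodClosed.Build R (G -> R^o) lucb lucb_submod_closed.

Definition LUCB := {f : G -> R^o | f \in lucb}.
HB.instance Definition _ := SubChoice.on LUCB.
HB.instance Definition _ := [SubChoice_isSubLmodule of LUCB by <:].

Definition LUCB_fun (f : LUCB) : G -> R := val f.
Coercion LUCB_fun : LUCB >-> Funclass.

Lemma lucb1 : (cst 1 : G -> R^o) \in lucb.
Proof.
apply/lucbP; split; first by exists 1 => x; rewrite normr1.
move=> e e0; exists setT => [|x y _]; first exact: filterT.
by rewrite subrr normr0 ltW.
Qed.

Definition LUCB_one : LUCB := Sub (cst 1) lucb1.

Lemma lucb_lmul (g : G) (f : LUCB) :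
  ((fun x => f (g * x)%g) : G -> R^o) \in lucb.
Proof.
have /lucbP[[M fM] uf] : val f \in lucb := valP f.
apply/lucbP; split; first by exists M => x; exact: fM.
move=> e /uf[U U1 fU]; exists U => // x y Uxy; apply: fU.
by rewrite invgM mulgA -[(_ * g)%g]mulgA mulVg mulg1.
Qed.

(* [f \o lambda_g], where [lambda_g x = g * x] *)
Definition LUCB_lmul (g : G) (f : LUCB) : LUCB :=
  Sub (fun x => f (g * x)%g) (lucb_lmul g f).

Definition is_mean (mu : {scalar LUCB}) : Prop :=
  (forall f : LUCB, (forall x, 0 <= f x) -> 0 <= mu f) /\ mu LUCB_one = 1.

Definition skew_amenable : Prop :=
  exists2 mu : {scalar LUCB}, is_mean mu &
    forall (f : LUCB) (g : G), mu (LUCB_lmul g f) = mu f.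

End LUCB.

Section Homeo.
Variable T : topologicalType.

Record homeo := Homeo {
  homeo_fun :> T -> T;
  homeo_inv : T -> T;
  homeoK : cancel homeo_fun homeo_inv;
  homeoVK : cancel homeo_inv homeo_fun;
  homeo_continuous : continuous homeo_fun;
  homeoV_continuous : continuous homeo_inv }.

Lemma homeo_ext (f g : homeo) : (forall x, f x = g x) -> f = g.
Proof.
case: f g => [f f' fK f'K cf cf'] [g g' gK g'K cg cg'] /= /funext fg.
subst g; have fg' : f' = g' by apply/funext => x; rewrite -{1}(g'K x) fK.
by subst g'; congr Homeo; exact: Prop_irrelevance.
Qed.

HB.instance Definition _ := gen_eqMixin homeo.
HB.instance Definition _ := gen_choiceMixin homeo.

Definition homeo1 : homeo :=
  @Homeo id id (fun=> erefl) (fun=> erefl) (fun x => cvg_id) (fun x => cvg_id).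

Definition homeoV (f : homeo) : homeo :=
  Homeo (@homeoVK f) (@homeoK f) (@homeoV_continuous f) (@homeo_continuous f).

Lemma continuous_comp_fun (f g : T -> T) :
  continuous f -> continuous g -> continuous (f \o g).
Proof. by move=> cf cg x; apply: continuous_comp; [exact: cg|exact: cf]. Qed.

Definition homeoM (f g : homeo) : homeo :=
  Homeo (can_comp (@homeoK f) (@homeoK g)) (can_comp (@homeoVK g) (@homeoVK f))
    (continuous_comp_fun (@homeo_continuous f) (@homeo_continuous g))
    (continuous_comp_fun (@homeoV_continuous g) (@homeoV_continuous f)).

Lemma homeoMA : associative homeoM.
Proof. by move=> f g h; apply: homeo_ext. Qed.
Lemma homeo1M : left_id homeo1 homeoM.
Proof. by move=> f; apply: homeo_ext. Qed.
Lemma homeoM1 : right_id homeo1 homeoM.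
Proof. by move=> f; apply: homeo_ext. Qed.
Lemma homeoVM : left_inverse homeo1 homeoV homeoM.
Proof. by move=> f; apply: homeo_ext => x /=; rewrite homeoK. Qed.
Lemma homeoMV : right_inverse homeo1 homeoV homeoM.
Proof. by move=> f; apply: homeo_ext => x /=; rewrite homeoVK. Qed.

HB.instance Definition _ :=
  isGroup.Build homeo homeoMA homeo1M homeoM1 homeoVM homeoMV.

End Homeo.

Section ProjectiveLine.
Variable R : realType.
Local Open Scope quotient_scope.

Definition sqnorm (v : 'cV[R]_2) : R := v 0 0 ^+ 2 + v 1 0 ^+ 2.

Definition S1 : set 'cV[R]_2 := [set v | sqnorm v = 1].

Definition antipodal (u v : S1) : bool :=
  (val u == val v) || (val u == - val v).

Lemma antipodal_refl : reflexive antipodal.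
Proof. by move=> u; rewrite /antipodal eqxx. Qed.
Lemma antipodal_sym : symmetric antipodal.
Proof. by move=> u v; rewrite /antipodal eq_sym -eqr_oppLR [- _ == _]eq_sym. Qed.
Lemma antipodal_trans : transitive antipodal.
Proof.
move=> v u w; rewrite /antipodal => /orP[]/eqP-> // /orP[]/eqP->.
  by rewrite eqxx orbT.
by rewrite opprK eqxx.
Qed.

Definition antipodal_equiv :=
  EquivRel antipodal antipodal_refl antipodal_sym antipodal_trans.

Definition P1 := {eq_quot antipodal_equiv}.
HB.instance Definition _ := Topological.copy P1 (quotient_topology P1).
HB.instance Definition _ := Quotient.on P1.

Definition ebase : 'cV[R]_2 := \col_i (i == 0)%:R.

Lemma ebase_S1 : ebase \in S1.
Proof. by rewrite inE /S1/= /sqnorm !mxE/= expr1n expr0n addr0. Qed.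

(* The point [v 0 0 : v 1 0]; it is meaningful only for v <> 0. *)
Definition line (v : 'cV[R]_2) : P1 :=
  \pi_P1 (insubd (Sub ebase ebase_S1 : S1) ((Num.sqrt (sqnorm v))^-1 *: v)).

Definition infty : P1 := line ebase.

(* One of the two unit vectors spanning the line p. *)
Definition unit_vec (p : P1) : 'cV[R]_2 := val (repr p).

Definition mobius (M : 'M[R]_2) (p : P1) : P1 := line (M *m unit_vec p).

Definition cross (u v : 'cV[R]_2) : R := u 0 0 * v 1 0 - v 0 0 * u 1 0.

(* The cyclic order of P1, oriented so that [x : 1], [y : 1], [z : 1] are in
   cyclic order when x < y < z.  Each vector occurs twice in the product, so
   that the sign depends only on the lines p, q, r. *)
Definition cyc (p q r : P1) : Prop :=
  0 < cross (unit_vec p) (unit_vec q) * cross (unit_vec q) (unit_vec r)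
      * cross (unit_vec r) (unit_vec p).

(* The closed interval from a to b in the cyclic order; it is a point if
   a = b. *)
Definition cyc_itv (a b : P1) : set P1 := [set x | [\/ x = a, x = b | cyc a x b]].

Lemma sqnorm_gt0 v : v != 0 -> 0 < sqnorm v.
Proof.
move=> v0; rewrite lt_neqAle addr_ge0 ?sqr_ge0// andbT eq_sym.
apply: contra v0; rewrite paddr_eq0 ?sqr_ge0// !sqrf_eq0 => /andP[/eqP a /eqP b].
apply/eqP/matrixP => i j; rewrite mxE (ord1 j).
by have [->|->] : i = 0 \/ i = 1 by case: i => -[|[|//]] ?; [left|right]; apply/val_inj.
Qed.

Lemma colP2 (u v : 'cV[R]_2) : u 0 0 = v 0 0 -> u 1 0 = v 1 0 -> u = v.
Proof.
move=> h0 h1; apply/matrixP => i j; rewrite (ord1 j).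
by have [->|->] : i = 0 \/ i = 1 by case: i => -[|[|//]] ?; [left|right]; apply/val_inj.
Qed.

Lemma unit_vecP p : sqnorm (unit_vec p) = 1.
Proof. by rewrite /unit_vec; case: (repr p) => v /= /set_mem. Qed.

Lemma unit_vec_neq0 p : unit_vec p != 0.
Proof.
apply/eqP => h; have := unit_vecP p; rewrite h /sqnorm !mxE expr0n addr0.
by move/eqP; rewrite eq_sym oner_eq0.
Qed.

Lemma cross_eq0 p q : cross (unit_vec p) (unit_vec q) = 0 -> p = q.
Proof.
move=> h; rewrite -[p]reprK -[q]reprK; apply/eqmodP => /=.
have := unit_vecP p; have := unit_vecP q; move: h.
rewrite /antipodal -/(unit_vec p) -/(unit_vec q) /sqnorm /cross.
move: (unit_vec p) (unit_vec q) => u v h hv hu.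
set s := u 0 0 * v 0 0 + u 1 0 * v 1 0.
have s2 : (s - 1) * (s + 1) = 0.
  transitivity ((u 0 0 ^+ 2 + u 1 0 ^+ 2) * (v 0 0 ^+ 2 + v 1 0 ^+ 2)
     - (u 0 0 * v 1 0 - v 0 0 * u 1 0) ^+ 2 - 1); first by rewrite /s; ring.
  by rewrite hu hv h; ring.
have [s1|s1] : s = 1 \/ s = -1.
  by move/eqP: s2; rewrite mulf_eq0 subr_eq0 addr_eq0 => /orP[]/eqP; [left|right].
- have /eqP : (u 0 0 - v 0 0) ^+ 2 + (u 1 0 - v 1 0) ^+ 2 = 0.
    transitivity (sqnorm u + sqnorm v - 2 * s); first by rewrite /s /sqnorm; ring.
    by rewrite /sqnorm hu hv s1; ring.
  rewrite paddr_eq0 ?sqr_ge0// !sqrf_eq0 !subr_eq0 => /andP[/eqP h0 /eqP h1].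
  by apply/orP; left; apply/eqP/colP2.
- have /eqP : (u 0 0 + v 0 0) ^+ 2 + (u 1 0 + v 1 0) ^+ 2 = 0.
    transitivity (sqnorm u + sqnorm v + 2 * s); first by rewrite /s /sqnorm; ring.
    by rewrite /sqnorm hu hv s1; ring.
  rewrite paddr_eq0 ?sqr_ge0// !sqrf_eq0 !addr_eq0 => /andP[/eqP h0 /eqP h1].
  by apply/orP; right; apply/eqP/colP2; rewrite !mxE.
Qed.

Lemma crossZl c u v : cross (c *: u) v = c * cross u v.
Proof. by rewrite /cross !mxE; ring. Qed.
Lemma crossZr c u v : cross u (c *: v) = c * cross u v.
Proof. by rewrite /cross !mxE; ring. Qed.
Lemma crossvv u : cross u u = 0.
Proof. by rewrite /cross; ring. Qed.
Lemma crossC u v : cross v u = - cross u v.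
Proof. by rewrite /cross; ring. Qed.

Lemma sum2 (F : 'I_2 -> R) : \sum_i F i = F 0 + F 1.
Proof. by rewrite !big_ord_recl big_ord0 addr0; congr (F _ + F _); apply/val_inj. Qed.

Lemma det22 (M : 'M[R]_2) : \det M = M 0 0 * M 1 1 - M 0 1 * M 1 0.
Proof.
rewrite (expand_det_row _ 0) sum2 /cofactor !det_mx11 !mxE /=.
have -> : lift (0 : 'I_2) (0 : 'I_1) = 1 by exact/val_inj.
have -> : lift (1 : 'I_2) (0 : 'I_1) = 0 by exact/val_inj.
by rewrite /= addn0 expr0 expr1; ring.
Qed.

Lemma crossM (M : 'M[R]_2) u v :
  cross (M *m u) (M *m v) = \det M * cross u v.
Proof. by rewrite det22 /cross !mxE !sum2; ring. Qed.

Lemma unit_vec_line v : v != 0 ->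
  exists2 c, c != 0 & unit_vec (line v) = c *: v.
Proof.
move=> v0; have n0 := sqnorm_gt0 v0.
pose w := (Num.sqrt (sqnorm v))^-1 *: v.
have wS : w \in S1.
  rewrite inE /S1/= /sqnorm !mxE !exprMn -mulrDr -/(sqnorm v) exprVn sqr_sqrtr ?ltW//.
  by rewrite mulVf// gt_eqF.
have s0 : (Num.sqrt (sqnorm v))^-1 != 0 by rewrite invr_eq0 gt_eqF// sqrtr_gt0.
have : antipodal (repr (line v)) (insubd (Sub ebase ebase_S1 : S1) w).
  by have /eqmodP := reprK (line v).
rewrite /antipodal -/(unit_vec _) val_insubd wS => /orP[]/eqP ->.
  by exists (Num.sqrt (sqnorm v))^-1.
by exists (- (Num.sqrt (sqnorm v))^-1); rewrite ?oppr_eq0// scaleNr.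
Qed.

Lemma eq_line u v : u != 0 -> v != 0 -> cross u v = 0 -> line u = line v.
Proof.
move=> /unit_vec_line[c c0 uE] /unit_vec_line[d d0 vE] h; apply: cross_eq0.
by rewrite uE vE crossZl crossZr h !mulr0.
Qed.

Lemma line_eq_point u p : u != 0 -> cross u (unit_vec p) = 0 -> line u = p.
Proof.
by move=> /unit_vec_line[c c0 uE] h; apply: cross_eq0; rewrite uE crossZl h mulr0.
Qed.

Lemma mulmx_neq0 (M : 'M[R]_2) (v : 'cV[R]_2) :
  \det M = 1 -> v != 0 -> M *m v != 0.
Proof.
move=> M1; apply: contra => /eqP Mv; rewrite -[v]mul1mx.
have Mu : M \in unitmx by rewrite unitmxE M1 unitr1.
by rewrite -(mulVmx Mu) -mulmxA Mv mulmx0.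
Qed.

Lemma unit_vec_mobius M p : \det M = 1 ->
  exists2 c, c != 0 & unit_vec (mobius M p) = c *: (M *m unit_vec p).
Proof. by move=> M1; apply/unit_vec_line/mulmx_neq0/unit_vec_neq0. Qed.

Lemma mobiusM M N p : \det M = 1 -> \det N = 1 ->
  mobius M (mobius N p) = mobius (M *m N) p.
Proof.
move=> M1 N1; have [c c0 E] := unit_vec_mobius p N1.
apply: eq_line.
- exact/mulmx_neq0/unit_vec_neq0.
- by apply/mulmx_neq0/unit_vec_neq0; rewrite det_mulmx M1 N1 mulr1.
- by rewrite E -scalemxAr mulmxA crossZl crossvv mulr0.
Qed.

Lemma mobius1 p : mobius 1%:M p = p.
Proof.
rewrite /mobius mul1mx; apply: line_eq_point; first exact: unit_vec_neq0.
exact: crossvv.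
Qed.

Lemma cyc_mobius M p q r : \det M = 1 ->
  cyc (mobius M p) (mobius M q) (mobius M r) <-> cyc p q r.
Proof.
move=> M1; rewrite /cyc.
have [a a0 ->] := unit_vec_mobius p M1.
have [b b0 ->] := unit_vec_mobius q M1.
have [c c0 ->] := unit_vec_mobius r M1.
rewrite !crossZl !crossZr !crossM M1 !mul1r.
set x := cross _ _; set y := cross _ (unit_vec r); set z := cross _ (unit_vec p).
rewrite (_ : _ * _ * _ = (a * b * c) ^+ 2 * (x * y * z)); last by ring.
by rewrite pmulr_rgt0// lt_def sqr_ge0 andbT sqrf_eq0 !mulf_neq0.
Qed.

Lemma mobius_inj M : \det M = 1 -> injective (mobius M).
Proof.
move=> M1 p q; have Mu : M \in unitmx by rewrite unitmxE M1 unitr1.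
have V1 : \det (invmx M) = 1 by rewrite det_inv M1 invr1.
by move=> /(congr1 (mobius (invmx M))); rewrite !mobiusM// mulVmx// !mobius1.
Qed.

Lemma cyc_itv_mobius M a b x : \det M = 1 ->
  cyc_itv (mobius M a) (mobius M b) (mobius M x) <-> cyc_itv a b x.
Proof.
move=> M1; split=> -[h|h|h].
- by apply: Or31; apply: mobius_inj h.
- by apply: Or32; apply: mobius_inj h.
- by apply/Or33/(cyc_mobius _ _ _ M1).
- by apply: Or31; rewrite h.
- by apply: Or32; rewrite h.
- by apply/Or33/(cyc_mobius _ _ _ M1).
Qed.

Lemma cyc_itv_cover a b x : a != b -> cyc_itv a b x \/ cyc_itv b a x.
Proof.
move=> ab; have [->|xa] := eqVneq x a; first by left; apply: Or31.
have [->|xb] := eqVneq x b; first by left; apply: Or32.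
have n0 p q : p != q -> cross (unit_vec p) (unit_vec q) != 0.
  by apply: contra => /eqP/cross_eq0/eqP.
rewrite /cyc_itv/= /cyc.
have := n0 _ _ xa; have := n0 _ _ xb; have := n0 _ _ ab.
rewrite (crossC (unit_vec x) (unit_vec b)) (crossC (unit_vec b) (unit_vec a)).
rewrite (crossC (unit_vec a) (unit_vec x)) !oppr_eq0.
set w := cross (unit_vec b) _; set v := cross (unit_vec x) _.
set u := cross (unit_vec a) _ => w0 v0 u0.
have : u * v * w != 0 by rewrite !mulf_neq0.
rewrite neq_lt => /orP[h|h]; [right|left]; apply: Or33; last exact: h.
have -> : - v * - u * - w = - (u * v * w) by ring.
by rewrite oppr_gt0.
Qed.

End ProjectiveLine.

Section Arcs.
Variable R : realType.
Implicit Types (a b c d p q x y z : P1 R).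

(* A coordinate on P1 minus {x}, increasing for the cyclic order. *)
Let coord (x y : P1 R) : R :=
  (unit_vec x 0 0 * unit_vec y 0 0 + unit_vec x 1 0 * unit_vec y 1 0)
  / cross (unit_vec x) (unit_vec y).

Let cross_neq0 p q : q != p -> cross (unit_vec p) (unit_vec q) != 0.
Proof. by apply: contra => /eqP/cross_eq0->. Qed.

Let cross_coord x y z : y != x -> z != x ->
  cross (unit_vec y) (unit_vec z) =
  cross (unit_vec x) (unit_vec y) * cross (unit_vec x) (unit_vec z)
  * (coord x y - coord x z).
Proof.
move=> yx zx; have y0 := cross_neq0 yx; have z0 := cross_neq0 zx.
have E w : w != x -> cross (unit_vec x) (unit_vec w) * coord x w =
    unit_vec x 0 0 * unit_vec w 0 0 + unit_vec x 1 0 * unit_vec w 1 0.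
  by move=> wx; rewrite /coord mulrC divfK// cross_neq0.
rewrite mulrBr -[X in _ - X]mulrA (E _ zx) mulrAC (E _ yx).
rewrite -[LHS]mul1r -(unit_vecP x) /sqnorm /cross; ring.
Qed.

Let coord_inj x y z : y != x -> z != x -> coord x y = coord x z -> y = z.
Proof.
move=> yx zx e; apply: cross_eq0.
by rewrite (cross_coord yx zx) e subrr mulr0.
Qed.

Let cyc_mid x a b : a != x -> b != x -> cyc a x b <-> coord x b < coord x a.
Proof.
move=> ax bx; rewrite /cyc (cross_coord bx ax) (crossC (unit_vec x)).
have := cross_neq0 ax; have := cross_neq0 bx.
set u := cross _ _; set v := cross _ _ => u0 v0.
rewrite (_ : _ * _ * _ = (u * v) ^+ 2 * (coord x a - coord x b)); last by ring.
by rewrite pmulr_rgt0 ?subr_gt0// lt_def sqr_ge0 andbT sqrf_eq0 mulf_neq0.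
Qed.

Let cycC a b c : cyc a b c <-> cyc b c a.
Proof. by rewrite /cyc -mulrA mulrC. Qed.

Let cyc_coord x a y b : a != x -> y != x -> b != x -> coord x b < coord x a ->
  cyc a y b <-> coord x y < coord x b \/ coord x a < coord x y.
Proof.
move=> ax yx bx ba; rewrite /cyc.
rewrite (cross_coord ax yx) (cross_coord yx bx) (cross_coord bx ax).
have := cross_neq0 ax; have := cross_neq0 bx; have := cross_neq0 yx.
move: ba; move: (coord x a) (coord x y) (coord x b) => s t r rs.
set u := cross _ _; set v := cross _ _; set w := cross _ _ => u0 v0 w0.
rewrite (_ : _ * _ * _ =
  ((u * v * w) ^+ 2 * (s - r)) * ((t - s) * (t - r))); last by ring.
rewrite pmulr_rgt0; last first.
  by rewrite mulr_gt0 ?subr_gt0// lt_def sqr_ge0 andbT sqrf_eq0 !mulf_neq0.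
split=> [h|[h|h]]; [|nra|nra].
have [st|ts] := ltP s t; first by right.
by left; nra.
Qed.

Let cyc_itv_gen x a b y : a != x -> b != x -> cyc_itv a b x -> y != x ->
  cyc_itv a b y <-> coord x y <= coord x b \/ coord x a <= coord x y.
Proof.
move=> ax bx [xa|xb|/(cyc_mid ax bx) ba] yx.
- by rewrite xa eqxx in ax.
- by rewrite xb eqxx in bx.
split=> [[->|->|/(cyc_coord ax yx bx ba)[/ltW h|/ltW h]]|[]].
- by right.
- by left.
- by left.
- by right.
- rewrite le_eqVlt => /orP[/eqP/(coord_inj yx bx)->|h]; first exact: Or32.
  by apply/Or33/(cyc_coord ax yx bx ba); left.
- rewrite le_eqVlt => /orP[/eqP/(coord_inj ax yx)->|h]; first exact: Or31.
  by apply/Or33/(cyc_coord ax yx bx ba); right.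
Qed.

Let cyc_itv_left x b y : b != x -> y != x -> cyc_itv x b y <-> coord x y <= coord x b.
Proof.
move=> bx yx; split=> [[/eqP|->//|/cycC/cycC/(cyc_mid bx yx)/ltW//]|].
  by rewrite (negbTE yx).
rewrite le_eqVlt => /orP[/eqP/(coord_inj yx bx)->|h]; first exact: Or32.
by apply/Or33/cycC/cycC/(cyc_mid bx yx).
Qed.

Let cyc_itv_right x a y : a != x -> y != x -> cyc_itv a x y <-> coord x a <= coord x y.
Proof.
move=> ax yx; split=> [[->//|/eqP|/cycC/(cyc_mid yx ax)/ltW//]|].
  by rewrite (negbTE yx).
rewrite le_eqVlt => /orP[/eqP/(coord_inj ax yx)->|h]; first exact: Or31.
by apply/Or33/cycC/(cyc_mid yx ax).
Qed.

Let cyc_itv_pt x y : cyc_itv x x y -> y = x.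
Proof. by case=> //; rewrite /cyc crossvv mulr0 ltxx. Qed.

Let cyc_itv_gen_mem x a b : a != x -> b != x -> cyc_itv a b x <-> coord x b < coord x a.
Proof.
move=> ax bx; split=> [|h]; last exact/Or33/(cyc_mid ax bx).
by case=> [/eqP|/eqP|/(cyc_mid ax bx)//]; rewrite eq_sym ?(negbTE ax) ?(negbTE bx).
Qed.

Lemma cyc_itv_inter a b c d x : cyc_itv a b x -> cyc_itv c d x ->
  exists p q, [/\ p = a \/ p = c, q = b \/ q = d, cyc_itv p q x &
    forall y, cyc_itv p q y -> cyc_itv a b y /\ cyc_itv c d y].
Proof.
move=> abx cdx.
have [p [pE p1 p2]] : exists p, [/\ p = a \/ p = c,
    p != x -> [/\ a != x, c != x, coord x a <= coord x p & coord x c <= coord x p]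
  & True].
  have [ax|ax] := eqVneq a x; first by exists a; rewrite ax eqxx; split=> //; left.
  have [cx|cx] := eqVneq c x; first by exists c; rewrite cx eqxx; split=> //; right.
  have [h|h] := leP (coord x a) (coord x c).
    by exists c; split=> [|_|//]; [right|split].
  by exists a; split=> [|_|//]; [left|split=> //; exact: ltW].
have [q [qE q1 q2]] : exists q, [/\ q = b \/ q = d,
    q != x -> [/\ b != x, d != x, coord x q <= coord x b & coord x q <= coord x d]
  & True].
  have [bx|bx] := eqVneq b x; first by exists b; rewrite bx eqxx; split=> //; left.
  have [dx|dx] := eqVneq d x; first by exists d; rewrite dx eqxx; split=> //; right.
  have [h|h] := leP (coord x b) (coord x d).
    by exists b; split=> [|_|//]; [left|split].
  by exists d; split=> [|_|//]; [right|split=> //; exact: ltW].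
exists p, q.
have pqx : cyc_itv p q x.
  have [->|px] := eqVneq p x; first exact: Or31.
  have [->|qx] := eqVneq q x; first exact: Or32.
  have [ax cx ap cp] := p1 px; have [bx dx qb qd] := q1 qx.
  apply/(cyc_itv_gen_mem px qx); apply: le_lt_trans qb _.
  by apply: lt_le_trans ap; apply/(cyc_itv_gen_mem ax bx).
split=> // y pqy.
have [->//|yx] := eqVneq y x.
have gen e f : cyc_itv e f x ->
  (p != x -> e != x /\ coord x e <= coord x p) ->
  (q != x -> f != x /\ coord x q <= coord x f) -> cyc_itv e f y.
  move=> efx ep fq.
  have [pE'|px] := eqVneq p x; have [qE'|qx] := eqVneq q x.
  - by move: pqy; rewrite pE' qE' => /cyc_itv_pt /eqP; rewrite (negbTE yx).
  - have [fx qf] := fq qx; move: pqy; rewrite pE' (cyc_itv_left qx yx) => yq.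
    have [->|ex] := eqVneq e x; first by apply/(cyc_itv_left fx yx); exact: le_trans qf.
    by apply/(cyc_itv_gen ex fx efx yx); left; exact: le_trans qf.
  - have [ex ep'] := ep px; move: pqy; rewrite qE' (cyc_itv_right px yx) => py.
    have [->|fx] := eqVneq f x.
      by apply/(cyc_itv_right ex yx); exact: le_trans py.
    by apply/(cyc_itv_gen ex fx efx yx); right; exact: le_trans py.
  - have [ex ep'] := ep px; have [fx qf] := fq qx.
    apply/(cyc_itv_gen ex fx efx yx); move/(cyc_itv_gen px qx pqx yx) : pqy => [h|h].
      by left; exact: le_trans qf.
    by right; exact: le_trans h.
split.
  apply: (gen a b abx) => [/p1[ax _ ap _]|/q1[bx _ qb _]]; first exact: conj ax ap.
  exact: conj bx qb.
apply: (gen c d cdx) => [/p1[_ cx _ cp]|/q1[_ dx _ qd]]; first exact: conj cx cp.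
exact: conj dx qd.
Qed.

End Arcs.

Lemma ptws_discrete_nbhs (I T : choiceType)
    (f : {ptws I -> discrete_topology T})
    (U : set {ptws I -> discrete_topology T}) :
  nbhs f U -> exists s : seq I,
    [set g | forall x, x \in s -> g x = f x] `<=` U.
Proof.
pose B (s : seq I) := [set g : {ptws I -> discrete_topology T} |
  forall x, x \in s -> g x = f x].
have FF : Filter (filter_from [set: seq I] B).
  apply: filter_from_filter; first by exists [::].
  move=> s t _ _; exists (s ++ t) => // g gf.
  by split=> x xs; apply: gf; rewrite mem_cat xs ?orbT.
have cvgF : filter_from [set: seq I] B --> f.
  apply/cvg_sup => i V; rewrite nbhsE => -[W [[C oC <-] Cf] WV].
  exists [:: i] => // g gf; apply: WV => /=.
  by rewrite gf ?mem_head.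
by move=> /cvgF[s _ sU]; exists s.
Qed.

Section Monod.
Variables (R : realType) (A : subringClosed R).

Definition SL2 : set 'M[R]_2 := [set M | M \is a mxOver A /\ \det M = 1].

(* Elements of PSL(2, A) are represented by matrices in SL(2, A): M and - M
   have the same trace up to sign, and the same action on P1. *)
Definition hyperbolic (M : 'M[R]_2) : Prop := 2 < `|\tr M|.

Definition hyperbolic_fixed : set (P1 R) :=
  [set p | exists M, [/\ SL2 M, hyperbolic M & mobius M p = p]].

(* P1 is a union of finitely many closed intervals with endpoints in P_A, on
   each of which f is given by an element of PSL(2, A).  Intervals with a common
   point are allowed, as are intervals reduced to a point; for a homeomorphism f
   this is no more general than a partition into nondegenerate intervals. *)
Definition piecewise_PSL2 (f : P1 R -> P1 R) : Prop :=
  exists s : seq (P1 R * P1 R),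
    (forall ab, ab \in s ->
       [/\ hyperbolic_fixed ab.1, hyperbolic_fixed ab.2 &
         exists2 M, SL2 M & forall x, cyc_itv ab.1 ab.2 x -> f x = mobius M x]) /\
    (forall x, exists2 ab, ab \in s & cyc_itv ab.1 ab.2 x).

Definition monod_pred : {pred homeo (P1 R)} := [pred f : homeo (P1 R) |
  `[< f (infty R) = infty R /\ piecewise_PSL2 f >]].

Lemma monod_predP (f : homeo (P1 R)) :
  reflect (f (infty R) = infty R /\ piecewise_PSL2 f) (f \in monod_pred).
Proof. exact: asboolP. Qed.

Lemma SL2_1 : SL2 1%:M.
Proof. by split; [rewrite mxOver_scalar ?rpred0 ?rpred1|rewrite det1]. Qed.

Lemma SL2_M M N : SL2 M -> SL2 N -> SL2 (M *m N).
Proof.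
move=> [MA M1] [NA N1]; split; first exact: mxOverM.
by rewrite det_mulmx M1 N1 mulr1.
Qed.

Lemma SL2_V M : SL2 M -> SL2 (invmx M).
Proof.
move=> [MA M1]; split; last by rewrite det_inv M1 invr1.
rewrite /invmx unitmxE M1 unitr1 invr1 scale1r; apply/mxOverP => i j.
rewrite mxE /cofactor det_mx11 !mxE rpredM//; last exact: (mxOverP MA).
by rewrite rpredX// rpredN rpred1.
Qed.

Lemma SL2_unit M : SL2 M -> M \in unitmx.
Proof. by move=> [_ M1]; rewrite unitmxE M1 unitr1. Qed.

Lemma mobiusK M : SL2 M -> cancel (mobius M) (mobius (invmx M)).
Proof.
move=> MS p; rewrite mobiusM ?mulVmx ?mobius1//; first exact: SL2_unit.
  exact: (SL2_V MS).2.
exact: MS.2.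
Qed.

Lemma mobiusVK M : SL2 M -> cancel (mobius (invmx M)) (mobius M).
Proof.
move=> MS p; rewrite mobiusM ?mulmxV ?mobius1//; first exact: SL2_unit.
  exact: MS.2.
exact: (SL2_V MS).2.
Qed.

Lemma hyperbolic_fixed_mobius M p :
  SL2 M -> hyperbolic_fixed p -> hyperbolic_fixed (mobius M p).
Proof.
move=> MS [N [NS Nh Np]]; have VS := SL2_V MS.
exists (M *m N *m invmx M); split.
- by apply: SL2_M => //; exact: SL2_M.
- by rewrite /hyperbolic mxtrace_mulC mulmxA mulVmx ?mul1mx//; exact: SL2_unit.
- have SMN := SL2_M MS NS.
  rewrite -mobiusM ?SMN.2 ?VS.2// mobiusK// -mobiusM ?MS.2 ?NS.2//.
  by rewrite Np.
Qed.

(* the point [x : 1] *)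
Let pt (x : R) : 'cV[R]_2 := \col_i (if i == 0 then x else 1).

Let pt_neq0 x : pt x != 0.
Proof.
apply/eqP => /matrixP/(_ 1 0); rewrite !mxE /= => /eqP.
by rewrite oner_eq0.
Qed.

Let goldM : 'M[R]_2 := \matrix_(i, j) (if (i == 0) && (j == 0) then 2 else 1).

Let goldM_fixed x : x ^+ 2 = x + 1 -> hyperbolic_fixed (line (pt x)).
Proof.
move=> x2; exists goldM.
have det1 : \det goldM = 1 by rewrite det22 !mxE /=; ring.
split.
- split=> //; apply/mxOverP => i j; rewrite mxE.
  by case: ifP => _; rewrite ?rpred_nat ?rpred1.
- rewrite /hyperbolic /mxtrace sum2 /= /goldM !mxE /=; rewrite ger0_norm; lra.
- rewrite /mobius; have [c c0 ->] := unit_vec_line (pt_neq0 x).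
  apply: eq_line => //; first by rewrite mulmx_neq0// scaler_eq0 negb_or c0 pt_neq0.
  rewrite -scalemxAr crossZl [X in c * X](_ : _ = 0) ?mulr0//.
  rewrite /cross !mxE !sum2 /goldM !mxE /=.
  transitivity (x + 1 - x ^+ 2); first by ring.
  by rewrite x2 subrr.
Qed.

Let hyperbolic_fixed2 :
  exists a b, [/\ a != b, hyperbolic_fixed a & hyperbolic_fixed b].
Proof.
have s5 : Num.sqrt 5 ^+ 2 = 5 :> R by rewrite sqr_sqrtr.
have s50 : 0 < Num.sqrt 5 :> R by rewrite sqrtr_gt0.
set s := Num.sqrt 5 in s5 s50.
exists (line (pt ((1 + s) / 2))), (line (pt ((1 - s) / 2))); split.
- apply/eqP => h.
  have [c c0 cE] := unit_vec_line (pt_neq0 ((1 + s) / 2)).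
  have [d d0 dE] := unit_vec_line (pt_neq0 ((1 - s) / 2)).
  have := crossvv (unit_vec (line (pt ((1 + s) / 2)))).
  rewrite {2}h cE dE crossZl crossZr => /eqP; rewrite !mulf_eq0 (negbTE c0) (negbTE d0)/=.
  by rewrite /cross !mxE /= => /eqP; lra.
- apply: goldM_fixed; rewrite exprMn (_ : (1 + s) ^+ 2 = 1 + s * 2 + s ^+ 2); last by ring.
  by rewrite s5; field.
- apply: goldM_fixed; rewrite exprMn (_ : (1 - s) ^+ 2 = 1 - s * 2 + s ^+ 2); last by ring.
  by rewrite s5; field.
Qed.

Lemma piecewise_PSL2_id : piecewise_PSL2 id.
Proof.
have [a [b [ab aH bH]]] := hyperbolic_fixed2.
exists [:: (a, b); (b, a)]; split.
  move=> p; rewrite !inE => /orP[]/eqP-> /=; split=> //; exists 1%:M => //.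
  - exact: SL2_1.
  - by move=> x _; rewrite mobius1.
  - exact: SL2_1.
  - by move=> x _; rewrite mobius1.
move=> x; have [h|h] := cyc_itv_cover x ab.
  by exists (a, b); rewrite ?inE ?eqxx.
by exists (b, a); rewrite ?inE ?eqxx ?orbT.
Qed.

Lemma piecewise_PSL2_inv (f : homeo (P1 R)) :
  piecewise_PSL2 f -> piecewise_PSL2 (homeo_inv f).
Proof.
move=> [s [sP scov]]; exists [seq (f ab.1, f ab.2) | ab <- s]; split.
  move=> _ /mapP[[a b] /sP/= [aH bH [M MS fM]] ->]/=.
  have fa : f a = mobius M a by apply: fM; exact: Or31.
  have fb : f b = mobius M b by apply: fM; exact: Or32.
  split; [by rewrite fa; exact: hyperbolic_fixed_mobius|
          by rewrite fb; exact: hyperbolic_fixed_mobius|].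
  exists (invmx M); first exact: SL2_V.
  move=> x; rewrite fa fb -{1}[x](mobiusVK MS).
  move/(cyc_itv_mobius _ _ _ MS.2)/fM => fx.
  by rewrite -[in LHS](mobiusVK MS x) -fx homeoK.
move=> x; have [[a b] abs abx] := scov (homeo_inv f x).
exists (f a, f b); first by apply/mapP; exists (a, b).
have [/= _ _ [M MS fM]] := sP _ abs.
rewrite /= -[x](homeoVK f) (fM a) ?(fM b) ?(fM _ abx); last 2 first.
- exact: Or32.
- exact: Or31.
exact/(cyc_itv_mobius _ _ _ MS.2).
Qed.

Lemma piecewise_PSL2_comp (f g : P1 R -> P1 R) :
  piecewise_PSL2 f -> piecewise_PSL2 g -> piecewise_PSL2 (f \o g).
Proof.
move=> [s [sP scov]] [t [tP tcov]].
pose good (pq : P1 R * P1 R) := [/\ hyperbolic_fixed pq.1, hyperbolic_fixed pq.2 &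
  exists2 M, SL2 M & forall x, cyc_itv pq.1 pq.2 x -> f (g x) = mobius M x].
have [h hP] : exists h : P1 R * P1 R -> 'M[R]_2, forall ab, ab \in t ->
    SL2 (h ab) /\ forall x, cyc_itv ab.1 ab.2 x -> g x = mobius (h ab) x.
  have H (ab : P1 R * P1 R) : exists M, ab \in t ->
      SL2 M /\ forall x, cyc_itv ab.1 ab.2 x -> g x = mobius M x.
    case: (boolP (ab \in t)) => [/tP[_ _ [M MS gM]]|_]; first by exists M.
    by exists 0.
  by have [h hP] := choice H; exists h.
pose pull (ab cd : P1 R * P1 R) :=
  (mobius (invmx (h ab)) cd.1, mobius (invmx (h ab)) cd.2).
pose cand := [seq (p, q) |
  p <- flatten [seq [:: ab.1; (pull ab cd).1] | ab <- t, cd <- s],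
  q <- flatten [seq [:: ab.2; (pull ab cd).2] | ab <- t, cd <- s]].
exists [seq pq <- cand | `[< good pq >]]; split.
  by move=> pq; rewrite mem_filter => /andP[/asboolP].
move=> x; have [ab abt abx] := tcov x; have [cd cds cdx] := scov (g x).
have [hS gh] := hP _ abt; have [aH bH _] := tP _ abt.
have [cH dH [N NS fN]] := sP _ cds.
have pullE y : cyc_itv (pull ab cd).1 (pull ab cd).2 y <->
    cyc_itv cd.1 cd.2 (mobius (h ab) y).
  rewrite -(cyc_itv_mobius _ _ y hS.2) /pull /=.
  by rewrite !(mobiusVK hS).
have pullx : cyc_itv (pull ab cd).1 (pull ab cd).2 x by apply/pullE; rewrite -gh.
have [p [q [pE qE pqx pqP]]] := cyc_itv_inter abx pullx.
have mem_ab (F : P1 R * P1 R -> P1 R * P1 R -> seq (P1 R)) z :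
    z \in F ab cd -> z \in flatten [seq F ab' cd' | ab' <- t, cd' <- s].
  move=> zF; apply/flattenP; exists (F ab cd) => //.
  exact: allpairs_f.
exists (p, q) => //; rewrite mem_filter; apply/andP; split.
  apply/asboolP; split => /=.
  - case: pE => -> //; apply: hyperbolic_fixed_mobius => //; exact: SL2_V.
  - case: qE => -> //; apply: hyperbolic_fixed_mobius => //; exact: SL2_V.
  - exists (N *m h ab); first exact: SL2_M.
    move=> y /pqP[/gh gy /pullE]; rewrite -gy => /fN ->.
    by rewrite gy mobiusM// ?NS.2 ?hS.2.
apply: allpairs_f.
  apply: (mem_ab (fun ab cd => [:: ab.1; (pull ab cd).1])).
  by rewrite !inE; case: pE => ->; rewrite eqxx ?orbT.
apply: (mem_ab (fun ab cd => [:: ab.2; (pull ab cd).2])).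
by rewrite !inE; case: qE => ->; rewrite eqxx ?orbT.
Qed.

Lemma monod_group_closed : group_closed monod_pred.
Proof.
split; first by apply/monod_predP; split=> //; exact: piecewise_PSL2_id.
move=> f g /monod_predP[fi fP] /monod_predP[gi gP]; apply/monod_predP; split.
  by rewrite /= -{1}gi homeoK.
by apply: piecewise_PSL2_comp => //; exact: piecewise_PSL2_inv.
Qed.

(* The group H(A). *)
Definition monod := {f : homeo (P1 R) | f \in monod_pred}.
HB.instance Definition _ := SubChoice.on monod.
HB.instance Definition _ :=
  SubChoice_isSubGroup.Build (homeo (P1 R)) _ monod monod_group_closed.

(* The group H(A) with the topology of pointwise convergence on the discrete
   space P1. *)
Definition monod_p := monod.

Definition monod_p_fun (h : monod_p) : {ptws P1 R -> discrete_topology (P1 R)} :=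
  val h : P1 R -> P1 R.

HB.instance Definition _ := Group.on monod_p.
HB.instance Definition _ :=
  Topological.copy monod_p (initial_topology monod_p_fun).

Lemma monod_p_nbhsP (h : monod_p) (U : set monod_p) :
  nbhs h U <-> exists s : seq (P1 R),
    [set k : monod_p | forall x, x \in s -> val k x = val h x] `<=` U.
Proof.
split=> [|[s sU]].
  rewrite nbhsE => -[_ [[V oV <-] Vh] VU].
  have /ptws_discrete_nbhs[s sV] : nbhs (monod_p_fun h) V by exact: open_nbhs_nbhs.
  by exists s => k kh; apply: VU; apply: sV.
apply: (filterS sU) => {U sU}; elim: s => [|x s IHs].
  by apply: filterS filterT => k _ x; rewrite in_nil.
have cx W : nbhs (monod_p_fun h x : discrete_topology (P1 R)) W ->
    nbhs h [set k : monod_p | W (monod_p_fun k x)].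
  move=> /(@proj_continuous _ (fun=> discrete_topology (P1 R)) x (monod_p_fun h)).
  exact: (@initial_continuous _ _ monod_p_fun h).
have /cx := discrete_set1 (monod_p_fun h x : discrete_topology (P1 R)).
move=> hx; apply: filterS (filterI hx IHs) => k [kx ks] y.
by rewrite inE => /predU1P[->//|/ks].
Qed.

Lemma monod_p_mul_continuous :
  continuous (fun x : monod_p * monod_p => (x.1 * x.2)%g).
Proof.
move=> [f g] U /monod_p_nbhsP[s sU].
exists ([set k : monod_p | forall x, x \in map (val g) s -> val k x = val f x],
  [set k : monod_p | forall x, x \in s -> val k x = val g x]).
  by split; apply/monod_p_nbhsP; eexists; exact: subset_refl.
move=> [f' g'] /= [ff' gg']; apply: sU => x xs.
change (val f' (val g' x) = val f (val g x)).
by rewrite gg'// ff'//; exact: map_f.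
Qed.

Lemma monod_p_inv_continuous : continuous (fun x : monod_p => (x^-1)%g).
Proof.
move=> f U /monod_p_nbhsP[s sU]; apply/monod_p_nbhsP.
exists (map (homeo_inv (val f)) s) => f' ff'; apply: sU => x xs.
change (homeo_inv (val f') x = homeo_inv (val f) x).
by rewrite -{1}[x](homeoVK (val f)) -ff' ?homeoK//; exact: map_f.
Qed.

HB.instance Definition _ :=
  isTopologicalGroup.Build monod_p monod_p_mul_continuous monod_p_inv_continuous.

End Monod.

(* Main.v *)
From HB Require Import structures.
Require Import Defs.
From mathcomp Require Import all_boot all_order all_algebra.
From mathcomp Require Import generic_quotient.
From mathcomp Require Import ring lra.
From mathcomp Require Import all_classical all_reals all_analysis.
Import numFieldNormedType.Exports.

Set Implicit Arguments.
Unset Strict Implicit.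
Unset Printing Implicit Defensive.

Import Order.TTheory GRing.Theory Num.Theory.

Local Open Scope classical_set_scope.
Local Open Scope ring_scope.

(** A bounded left-uniformly continuous function f on H(A)_p depends, up to any
error, only on the restriction of its argument to a finite set of points of
P^1 ([lucb_near_eq]).  This makes only the germs at +oo matter: every element
of H(A) coincides near +oo with an affine map x |-> s x + c ([monod_germ]), the
translations t_a : x |-> x + a with a in A belong to H(A)
([monod_translation]), and t_a pushes any given finite set of real points
towards +oo.  Hence, when g and h have the same germ at +oo, f (g t_a) and
f (h t_a) become arbitrarily close as a tends to +oo in A.

The germs at +oo form a group of affine maps, which is metabelian, and the mean
is built in two steps along the translations and the slopes.  Let m be a mean
on functions of a in A which is invariant under translation and depends only on
what happens as a tends to +oo.  Set psi f g = m (a |-> f (g t_a)).  If g and h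
have germs with the same slope s, these germs differ by a translation t_b
applied first, and b lies in A because the matrix of an element that fixes
infinity is upper triangular with unit determinant; thus psi f g = psi f h by
invariance of m ([mean_germ_slope]), and psi f is a function of the slope
alone.  Left translation of f by g multiplies the slope by that of g, so
averaging psi f with an invariant mean on the commutative group of slopes gives
a mean that is invariant under left translations.

Both means come from [invariant_filter_mean]: commuting transformations that
preserve a filter admit an invariant mean supported by that filter, obtained as
an ultralimit of iterated Cesaro averages. *)

(** * Means supported by a filter and invariant under commuting maps *)

Section FilterMeans.
Variable R : realType.

Definition bounded_function (X : Type) (f : X -> R) : Prop :=
  exists M : R, forall x, `|f x| <= M.

Lemma bounded_functionD (X : Type) (a : R) (f g : X -> R) :
  bounded_function f -> bounded_function g ->
  bounded_function (fun x => a * f x + g x).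
Proof.
move=> [M fM] [N gN]; exists (`|a| * M + N) => x.
by rewrite (le_trans (ler_normD _ _))// lerD// normrM ler_wpM2l.
Qed.

Lemma bounded_function_comp (X Y : Type) (h : Y -> X) (f : X -> R) :
  bounded_function f -> bounded_function (fun y => f (h y)).
Proof. by move=> [M fM]; exists M => y. Qed.

(** A functional on all functions, of which only the values on bounded functions
are constrained.  Domination by the upper limit along the filter encodes
positivity, normalization and support in the filter all at once. *)
Definition filter_mean (X : Type) (F : set_system X) (m : (X -> R) -> R) : Prop :=
  (forall a f g, bounded_function f -> bounded_function g ->
     m (fun x => a * f x + g x) = a * m f + m g) /\
  (forall f c, bounded_function f -> (\forall x \near F, f x <= c) -> m f <= c).

Section Theory.
Variables (X : Type) (F : set_system X) (m : (X -> R) -> R).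
Context {FF : Filter F}.
Hypothesis mF : filter_mean F m.

Lemma filter_meanN f : bounded_function f -> m (fun x => - f x) = - m f.
Proof.
move=> bf; have [lin _] := mF.
have m0 : m (fun x => -1 * f x + f x) = 0 by rewrite lin// mulN1r addNr.
have -> : (fun x => - f x) = (fun x => -1 * f x + (fun x => -1 * f x + f x) x).
  by apply/funext => x; ring.
by rewrite lin ?m0 ?addr0 ?mulN1r//; apply: bounded_functionD.
Qed.

Lemma filter_mean_ge f c :
  bounded_function f -> (\forall x \near F, c <= f x) -> c <= m f.
Proof.
move=> bf fc; rewrite -lerN2 -filter_meanN//; apply: mF.2.
  by have [M fM] := bf; exists M => x; rewrite normrN.
by apply: filterS fc => x; rewrite lerN2.
Qed.

Lemma filter_mean_norm_le f c :
  bounded_function f -> (\forall x \near F, `|f x| <= c) -> `|m f| <= c.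
Proof.
move=> bf fc; rewrite ler_norml filter_mean_ge ?mF.2//;
  by apply: filterS fc => x; rewrite ler_norml => /andP[].
Qed.

Lemma filter_mean_eq f g : bounded_function f -> bounded_function g ->
  (forall e, 0 < e -> \forall x \near F, `|f x - g x| <= e) -> m f = m g.
Proof.
move=> bf bg fg; apply/eqP; rewrite -subr_eq0 -normr_le0; apply/ler_addgt0Pl => e e0.
rewrite addr0.
have -> : m f - m g = m (fun x => -1 * g x + f x) by rewrite mF.1// mulN1r addrC.
apply: filter_mean_norm_le; first exact: bounded_functionD.
by apply: filterS (fg e e0) => x; rewrite mulN1r addrC.
Qed.

Lemma filter_mean1 : m (fun=> 1) = 1.
Proof.
have b1 : bounded_function (fun _ : X => 1) by exists 1 => x; rewrite normr1.
apply/eqP; rewrite eq_le mF.2 ?filter_mean_ge//; exact: nearW.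
Qed.

End Theory.

Lemma ultrafilter_cvg (X : Type) (U : set_system X) (f : X -> R) :
  UltraFilter U -> bounded_function f -> cvg (f x @[x --> U]).
Proof.
move=> UU [M fM].
have UfU : UltraFilter (f x @[x --> U]).
  split=> [|G GF fUG]; first exact: fmap_proper_filter.
  apply/seteqP; split=> [A GA|//].
  have [//|UnA] := in_ultra_setVsetC (f @^-1` A) UU.
  have GnA : G (~` A) by exact: fUG.
  have [] := @filter_not_empty _ G _.
  by rewrite -(setICr A); exact: filterI.
have := @segment_compact R (- M) M; rewrite compact_ultra.
move=> /(_ _ UfU)[]; last by move=> l [_ fl]; apply/cvg_ex; exists l.
by apply: nearW => x /=; rewrite in_itv/= -ler_norml.
Qed.

(** The limit along an ultrafilter that refines the filter; it exists because a
bounded function takes its values in a compact interval. *)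
Lemma filter_mean_exists (X : Type) (F : set_system X) :
  ProperFilter F -> exists m, filter_mean F m.
Proof.
move=> PF; have [U [UU FU]] := ultraFilterLemma PF.
exists (fun f => lim (f x @[x --> U])); split=> [a f g bf bg|f c bf fc].
  have cf := ultrafilter_cvg UU bf; have cg := ultrafilter_cvg UU bg.
  apply/cvg_lim => //; apply: cvgD => //; exact: cvgMr.
apply: limr_le; [exact: ultrafilter_cvg|exact: FU].
Qed.

Definition cesaro (X : Type) (T : X -> X) (n : nat) (f : X -> R) (x : X) : R :=
  n.+1%:R^-1 * \sum_(k < n.+1) f (iter k T x).

Section Cesaro.
Variables (X : Type) (T : X -> X) (n : nat).
Implicit Types f g : X -> R.

Lemma cesaro_le f c x : (forall k, f (iter k T x) <= c) -> cesaro T n f x <= c.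
Proof.
move=> fc; rewrite /cesaro ler_pdivrMl// mulrC mulr_natr -[X in _ *+ X]card_ord.
by rewrite -sumr_const ler_sum.
Qed.

Lemma cesaro_linear a f g x :
  cesaro T n (fun y => a * f y + g y) x = a * cesaro T n f x + cesaro T n g x.
Proof. by rewrite /cesaro big_split/= -mulr_sumr; ring. Qed.

Lemma cesaro_norm_le f M x : (forall y, `|f y| <= M) -> `|cesaro T n f x| <= M.
Proof.
move=> fM; rewrite ler_norml cesaro_le ?andbT; last first.
  by move=> k; rewrite (le_trans (ler_norm _)).
rewrite -lerN2 opprK.
rewrite (_ : - _ = cesaro T n (fun y => -1 * f y + 0) x); last first.
  by rewrite cesaro_linear mulN1r [X in _ + X](_ : _ = 0) ?addr0// /cesaro big1 ?mulr0.
by apply: cesaro_le => k; rewrite addr0 mulN1r (le_trans (ler_norm _))// normrN.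
Qed.

(** The sum telescopes: all but two of the terms cancel. *)
Lemma cesaro_coboundary f M x : (forall y, `|f y| <= M) ->
  `|cesaro T n (fun y => f (T y)) x - cesaro T n f x| <= 2 * M / n.+1%:R.
Proof.
move=> fM; rewrite /cesaro -mulrBr normrM (@ger0_norm _ _^-1) ?invr_ge0//.
rewrite [leRHS]mulrC ler_wpM2l ?invr_ge0//.
rewrite big_ord_recr big_ord_recl/=.
set S := \sum_(k < n) f (T (iter k T x)).
rewrite (_ : _ - _ = f (T (iter n T x)) - f x); last by rewrite -/S; ring.
by rewrite mulr_natl mulr2n (le_trans (ler_normB _ _))// lerD.
Qed.

End Cesaro.

Section IteratedAverages.
Variables (X : Type) (I : eqType) (T : I -> X -> X).
Implicit Types (p : seq I * nat) (s : seq I) (f g : X -> R).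

Definition cesaros p f : X -> R := foldr (fun i => cesaro (T i) p.2) f p.1.

Lemma cesarosS i s n f : cesaros (i :: s, n) f = cesaro (T i) n (cesaros (s, n) f).
Proof. by []. Qed.

Lemma cesaros_norm_le p f (M : R) :
  (forall x, `|f x| <= M) -> forall x, `|cesaros p f x| <= M.
Proof.
move=> fM; case: p => s n; elim: s => [//|i s IHs] x.
by rewrite cesarosS; exact: cesaro_norm_le.
Qed.

Lemma bounded_cesaros p f : bounded_function f -> bounded_function (cesaros p f).
Proof. by move=> [M fM]; exists M; exact: cesaros_norm_le. Qed.

Lemma cesaros_linear p a f g : cesaros p (fun x => a * f x + g x) =
  (fun x => a * cesaros p f x + cesaros p g x).
Proof.
case: p => s n; elim: s => [//|i s IHs]; rewrite !cesarosS IHs.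
by apply/funext => x; rewrite cesaro_linear.
Qed.

Lemma cesaros_near_le (F : set_system X) p f c : Filter F ->
  (forall i, T i x @[x --> F] --> F) ->
  (\forall x \near F, f x <= c) -> \forall x \near F, cesaros p f x <= c.
Proof.
move=> FF TF fc; case: p => s n; elim: s => [//|i s IHs]; rewrite cesarosS.
have iterF k : \forall x \near F, cesaros (s, n) f (iter k (T i) x) <= c.
  elim: k => [//|k IHk]; have h : F (T i @^-1` _) := TF i _ IHk.
  by apply: filterS h => x /=; rewrite -iterSr.
have : \forall x \near F, forall k : 'I_n.+1, cesaros (s, n) f (iter k (T i) x) <= c.
  by apply: filter_forall => k; exact: iterF.
by apply: filterS => x fx; rewrite /cesaro ler_pdivrMl// mulrC mulr_natr
  -[X in _ *+ X]card_ord -sumr_const ler_sum.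
Qed.

Hypothesis T_comm : forall i j x, T i (T j x) = T j (T i x).

Lemma cesaros_shift s n i f x :
  cesaros (s, n) (fun y => f (T i y)) x = cesaros (s, n) f (T i x).
Proof.
elim: s x => [//|j s IHs] x; rewrite !cesarosS /cesaro; congr (_ * _).
apply: eq_bigr => k _; rewrite IHs; congr cesaros.
by elim: (nat_of_ord k) => [//|l /= <-].
Qed.

(** The average over [T i] turns the difference into a small coboundary, and the
other averages, which commute with it, do not increase the norm. *)
Lemma cesaros_coboundary s n i f M x : i \in s -> (forall y, `|f y| <= M) ->
  `|cesaros (s, n) (fun y => f (T i y)) x - cesaros (s, n) f x| <=
    2 * M / n.+1%:R.
Proof.
move=> + fM; elim: s x => [//|j s IHs] x; rewrite inE !cesarosS.
case: eqVneq => /= [<- _|_ si].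
  rewrite (_ : cesaros (s, n) _ = fun y => cesaros (s, n) f (T i y)).
    by apply: cesaro_coboundary; exact: cesaros_norm_le.
  by apply/funext => y; exact: cesaros_shift.
rewrite [X in `|X|](_ : _ = cesaro (T j) n (fun y =>
    -1 * cesaros (s, n) f y + cesaros (s, n) (fun y => f (T i y)) y) x).
  by apply: cesaro_norm_le => y; rewrite mulN1r addrC; exact: IHs.
by rewrite cesaro_linear mulN1r addrC.
Qed.

End IteratedAverages.

(** A form of the Markov-Kakutani theorem.  The iterated averages over a finite
set s of the maps and the first n iterates are almost invariant under the
members of s, so a mean along increasing s and n of their limits along F is
invariant under all the maps. *)
Lemma invariant_filter_mean (X : Type) (I : eqType) (T : I -> X -> X)
    (F : set_system X) : ProperFilter F ->
  (forall i j x, T i (T j x) = T j (T i x)) ->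
  (forall i, T i x @[x --> F] --> F) ->
  exists2 m, filter_mean F m &
    forall i f, bounded_function f -> m (fun x => f (T i x)) = m f.
Proof.
move=> PF T_comm TF; have [m0 m0F] := filter_mean_exists PF.
pose B (p : seq I * nat) := [set q : seq I * nat | {subset p.1 <= q.1} /\ (p.2 <= q.2)%N].
have PK : ProperFilter (filter_from [set: seq I * nat] B).
  apply: filter_from_proper; last by move=> p _; exists p; split.
  apply: filter_from_filter; first by exists ([::], 0%N).
  move=> [s k] [t l] _ _; exists (s ++ t, maxn k l) => // -[r n] [/= srn kn].
  move: kn; rewrite geq_max => /andP[kn ln].
  by split; split => //= i ir; apply: srn; rewrite mem_cat ir ?orbT.
have [mK mKP] := filter_mean_exists PK.
have bnd0 f : bounded_function f -> bounded_function (fun p => m0 (cesaros T p f)).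
  move=> [M fM]; exists M => p; apply: (filter_mean_norm_le m0F).
    by apply: bounded_cesaros; exists M.
  by apply: nearW; exact: cesaros_norm_le.
exists (fun f => mK (fun p => m0 (cesaros T p f))).
  split=> [a f g bf bg|f c bf fc].
    rewrite -mKP.1; [|exact: bnd0|exact: bnd0]; congr mK; apply/funext => p.
    by rewrite cesaros_linear m0F.1//; exact: bounded_cesaros.
  apply: mKP.2; first exact: bnd0.
  apply: nearW => p; apply: m0F.2; first exact: bounded_cesaros.
  exact: cesaros_near_le.
move=> i f bf.
have bfi : bounded_function (fun x => f (T i x)) by exact: bounded_function_comp.
apply: (filter_mean_eq mKP); [exact: bnd0|exact: bnd0|move=> e e0].
have [M fM] := bf.
(* beyond this number of iterates, the coboundary bound is below e *)
exists ([:: i], Num.truncn (2 * M / e)) => // -[s n] [/= si kn].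
rewrite (_ : _ - _ = m0 (fun x => -1 * cesaros T (s, n) f x +
    cesaros T (s, n) (fun y => f (T i y)) x)); last first.
  by rewrite m0F.1 ?mulN1r 1?addrC//; exact: bounded_cesaros.
apply: (filter_mean_norm_le m0F).
  by apply: bounded_functionD; exact: bounded_cesaros.
apply: nearW => x; rewrite mulN1r addrC.
apply: le_trans (cesaros_coboundary T_comm n x _ fM) _.
  by apply: si; rewrite mem_head.
rewrite ler_pdivrMr// [leRHS]mulrC -ler_pdivrMr//.
by apply: le_trans (ltW (truncnS_gt _)) _; rewrite ler_nat.
Qed.

End FilterMeans.

(** * The affine chart and the germs of arcs at infinity *)

Section AffineChart.
Variable R : realType.
Implicit Types (p q a b : P1 R) (x y : R) (M : 'M[R]_2).

Definition affine_vec x : 'cV[R]_2 := \col_i (if i == 0 then x else 1).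

Definition affine_pt x : P1 R := line (affine_vec x).

Lemma affine_vec_neq0 x : affine_vec x != 0.
Proof.
by apply/eqP => /matrixP/(_ 1 0); rewrite !mxE /= => /eqP; rewrite oner_eq0.
Qed.

Lemma ebase_neq0 : ebase R != 0.
Proof.
by apply/eqP => /matrixP/(_ 0 0); rewrite !mxE /= => /eqP; rewrite oner_eq0.
Qed.

Lemma line_unit_vec p : line (unit_vec p) = p.
Proof. by apply: line_eq_point; [exact: unit_vec_neq0|exact: crossvv]. Qed.

Lemma eq_line_cross (u v : 'cV[R]_2) : u != 0 -> v != 0 ->
  line u = line v -> cross u v = 0.
Proof.
move=> /unit_vec_line[c c0 uE] /unit_vec_line[d d0 vE] uv.
have := crossvv (unit_vec (line u)); rewrite {2}uv uE vE crossZl crossZr => /eqP.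
by rewrite !mulf_eq0 (negbTE c0) (negbTE d0)/= => /eqP.
Qed.

Lemma affine_pt_inj : injective affine_pt.
Proof.
move=> x y /(eq_line_cross (affine_vec_neq0 x) (affine_vec_neq0 y)).
by rewrite /cross !mxE/= !mulr1 => /eqP; rewrite subr_eq0 => /eqP.
Qed.

Lemma affine_pt_neq_infty x : affine_pt x <> infty R.
Proof.
move/(eq_line_cross (affine_vec_neq0 x) ebase_neq0).
by rewrite /cross !mxE/= mulr0 mul1r sub0r => /eqP; rewrite oppr_eq0 oner_eq0.
Qed.

Lemma eq_infty p : unit_vec p 1 0 = 0 -> p = infty R.
Proof.
move=> p1; rewrite -[p]line_unit_vec; apply: eq_line.
- exact: unit_vec_neq0.
- exact: ebase_neq0.
- by rewrite /cross p1 !mxE/=; ring.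
Qed.

Lemma P1_cases p : p = infty R \/ exists x, p = affine_pt x.
Proof.
have [p1|p1] := eqVneq (unit_vec p 1 0) 0; first by left; exact: eq_infty.
right; exists (unit_vec p 0 0 / unit_vec p 1 0).
rewrite -[LHS]line_unit_vec; apply: eq_line.
- exact: unit_vec_neq0.
- exact: affine_vec_neq0.
- by rewrite /cross !mxE/=; field.
Qed.

Lemma mobius_line M (v : 'cV[R]_2) : \det M = 1 -> v != 0 ->
  mobius M (line v) = line (M *m v).
Proof.
move=> M1 v0; have [c c0 E] := unit_vec_line v0; apply: eq_line.
- exact/mulmx_neq0/unit_vec_neq0.
- exact: mulmx_neq0.
- by rewrite E -scalemxAr crossZl crossvv mulr0.
Qed.

Lemma mobius_infty M : \det M = 1 -> mobius M (infty R) = infty R -> M 1 0 = 0.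
Proof.
move=> M1; rewrite mobius_line ?ebase_neq0//.
move/(eq_line_cross (mulmx_neq0 M1 ebase_neq0) ebase_neq0).
rewrite /cross !mxE !sum2 !mxE/= !mulr1 !mulr0 !addr0 sub0r => /eqP.
by rewrite mul1r oppr_eq0 => /eqP.
Qed.

Lemma mobius_affine M x : \det M = 1 -> M 1 0 = 0 ->
  mobius M (affine_pt x) = affine_pt (M 0 0 ^+ 2 * x + M 0 0 * M 0 1).
Proof.
move=> M1 M10; rewrite mobius_line ?affine_vec_neq0//; apply: eq_line.
- exact/mulmx_neq0/affine_vec_neq0.
- exact: affine_vec_neq0.
- move: M1; rewrite det22 M10 mulr0 subr0 => M1.
  rewrite /cross !mxE !sum2 !mxE/= M10.
  transitivity ((M 0 0 * x + M 0 1) * (1 - M 0 0 * M 1 1)); first by ring.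
  by rewrite M1 subrr mulr0.
Qed.

Lemma cyc_line (u v w : 'cV[R]_2) : u != 0 -> v != 0 -> w != 0 ->
  cyc (line u) (line v) (line w) <-> 0 < cross u v * cross v w * cross w u.
Proof.
move=> /unit_vec_line[a a0 uE] /unit_vec_line[b b0 vE] /unit_vec_line[c c0 wE].
rewrite /cyc uE vE wE !crossZl !crossZr.
set x := cross u v; set y := cross v w; set z := cross w u.
rewrite (_ : _ * _ * _ = (a * b * c) ^+ 2 * (x * y * z)); last by ring.
by rewrite pmulr_rgt0// lt_def sqr_ge0 andbT sqrf_eq0 !mulf_neq0.
Qed.

Lemma near_sg_affine x y :
  \forall t \near +oo, Num.sg (x * t + y) = if x == 0 then Num.sg y else Num.sg x.
Proof.
case: (ltgtP x 0) => [x0|x0|->]; last first.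
  by apply: nearW => t; rewrite mul0r add0r.
- near=> t; rewrite (gtr0_sg x0) gtr0_sg// -ltrBlDr sub0r mulrC -ltr_pdivrMr//.
  by near: t; apply: nbhs_pinfty_gt; exact: num_real.
- near=> t; rewrite (ltr0_sg x0) ltr0_sg// -ltrBrDr sub0r mulrC -ltr_ndivrMr//.
  by near: t; apply: nbhs_pinfty_gt; exact: num_real.
Unshelve. all: by end_near. Qed.

Lemma near_affine_pt_neq p : \forall x \near +oo, affine_pt x <> p.
Proof.
have [->|[y ->]] := P1_cases p; first by apply: nearW; exact: affine_pt_neq_infty.
near=> x; move/affine_pt_inj => xy; have : y < x by near: x; apply: nbhs_pinfty_gt; exact: num_real.
by rewrite xy ltxx.
Unshelve. all: by end_near. Qed.

(** Membership of [x : 1] in an arc is governed by the sign of a product of two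
affine functions of x and a constant, hence is eventually constant.  If it
eventually holds, the arc contains the limit point because it is closed; this
is read off from the leading coefficients, one of them vanishing only when the
corresponding endpoint is infinity. *)
Lemma cyc_itv_near_infty a b :
  cyc_itv a b (infty R) /\ (\forall x \near +oo, cyc_itv a b (affine_pt x)) \/
  (\forall x \near +oo, ~ cyc_itv a b (affine_pt x)).
Proof.
set u := unit_vec a; set v := unit_vec b.
have cycE x : cyc a (affine_pt x) b <->
    0 < (- u 1 0 * x + u 0 0) * (v 1 0 * x + - v 0 0) * cross v u.
  rewrite -[a]line_unit_vec -[b]line_unit_vec.
  rewrite cyc_line ?unit_vec_neq0 ?affine_vec_neq0//.
  rewrite -/u -/v (_ : cross u _ = - u 1 0 * x + u 0 0); last first.
    by rewrite /cross !mxE/=; ring.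
  by rewrite (_ : cross _ v = v 1 0 * x + - v 0 0)// /cross !mxE/=; ring.
pose s := (if - u 1 0 == 0 then Num.sg (u 0 0) else Num.sg (- u 1 0)) *
  (if v 1 0 == 0 then Num.sg (- v 0 0) else Num.sg (v 1 0)) * Num.sg (cross v u).
have near_cyc : \forall x \near +oo, cyc a (affine_pt x) b <-> 0 < s.
  near=> x; rewrite cycE -(sgr_gt0 (_ * cross v u)) !sgrM /s.
  have -> : Num.sg (- u 1 0 * x + u 0 0) =
      if - u 1 0 == 0 then Num.sg (u 0 0) else Num.sg (- u 1 0).
    by near: x; exact: near_sg_affine.
  have -> // : Num.sg (v 1 0 * x - v 0 0) =
      if v 1 0 == 0 then Num.sg (- v 0 0) else Num.sg (v 1 0).
  by near: x; exact: near_sg_affine.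
have [s0|s0] := boolP (0 < s); last first.
  right; near=> x; case.
  - by near: x; exact: near_affine_pt_neq.
  - by near: x; exact: near_affine_pt_neq.
  - have -> : cyc a (affine_pt x) b <-> 0 < s by near: x.
    by rewrite (negbTE s0).
left; split; last first.
  near=> x; apply: Or33.
  by have -> : cyc a (affine_pt x) b <-> 0 < s by near: x.
have [u1|u1] := eqVneq (u 1 0) 0; first by apply: Or31; rewrite (eq_infty u1).
have [v1|v1] := eqVneq (v 1 0) 0; first by apply: Or32; rewrite (eq_infty v1).
apply: Or33; rewrite -[a]line_unit_vec -[b]line_unit_vec.
rewrite cyc_line ?unit_vec_neq0 ?ebase_neq0// -/u -/v.
rewrite (_ : cross u _ = - u 1 0); last by rewrite /cross !mxE/=; ring.
rewrite (_ : cross _ v = v 1 0); last by rewrite /cross !mxE/=; ring.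
by rewrite -sgr_gt0 !sgrM; move: s0; rewrite /s oppr_eq0 (negbTE u1) (negbTE v1).
Unshelve. all: by end_near. Qed.

(** A finite cover has a member that contains a whole neighborhood of +oo, and
it also contains infinity; on it a piecewise projective map that fixes infinity
is given by a matrix that fixes infinity. *)
Lemma cyc_itv_cover_near_infty (s : seq (P1 R * P1 R)) :
  (forall p, exists2 ab, ab \in s & cyc_itv ab.1 ab.2 p) ->
  exists2 ab, ab \in s & cyc_itv ab.1 ab.2 (infty R) /\
    \forall x \near +oo, cyc_itv ab.1 ab.2 (affine_pt x).
Proof.
move=> scov; apply: contrapT => no.
have : \forall x \near +oo, forall ab, ab \in s -> ~ cyc_itv ab.1 ab.2 (affine_pt x).
  elim: s no {scov} => [|ab s IHs] no; first exact: nearW.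
  have [ab_near|ab_far] := cyc_itv_near_infty ab.1 ab.2.
    by case: no; exists ab => //; exact: mem_head.
  have s_far : \forall x \near +oo, forall cd, cd \in s ->
      ~ cyc_itv cd.1 cd.2 (affine_pt x).
    by apply: IHs => -[cd cds ?]; apply: no; exists cd => //; rewrite inE cds orbT.
  apply: filterS2 ab_far s_far => x ab_far s_far cd.
  by rewrite inE => /predU1P[->|/s_far].
move=> far; near (pinfty_nbhs R) => x.
have [ab abs abx] := scov (affine_pt x).
by move: abs abx; apply: (near far x).
Unshelve. all: by end_near. Qed.

End AffineChart.

(** * Projective transformations are homeomorphisms *)

Section MobiusContinuous.
Variable R : realType.
Local Open Scope quotient_scope.

Lemma matrix_continuous (T : topologicalType) m n (f : T -> 'M[R]_(m, n)) :
  (forall i j, continuous (fun x => f x i j)) -> continuous f.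
Proof.
move=> cf x; apply/cvg_ballP => e e0.
have : \forall y \near x, forall i j, ball (f x i j) e (f y i j).
  apply: filter_forall => i; apply: filter_forall => j.
  by move/cvg_ballP : (cf i j x); exact.
by apply: filterS => y fxy; split.
Qed.

Lemma sqnorm_normalize (v : 'cV[R]_2) : v != 0 ->
  sqnorm ((Num.sqrt (sqnorm v))^-1 *: v) = 1.
Proof.
move=> /sqnorm_gt0 v0; rewrite /sqnorm !mxE !exprMn -mulrDr -/(sqnorm v) exprVn.
by rewrite sqr_sqrtr ?ltW// mulVf// gt_eqF.
Qed.

Lemma mulmx_continuous (T : topologicalType) (M : 'M[R]_2) (f : T -> 'cV[R]_2) :
  (forall i, continuous (fun x => f x i 0)) ->
  forall i, continuous (fun x => (M *m f x) i 0).
Proof.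
move=> cf i; have -> : (fun x => (M *m f x) i 0) =
    (fun x => M i 0 * f x 0 0 + M i 1 * f x 1 0).
  by apply/funext => x; rewrite mxE sum2.
move=> x; apply: cvgD; apply: cvgMr; exact: cf.
Qed.

Lemma normalize_continuous (T : topologicalType) (f : T -> 'cV[R]_2) :
  (forall i, continuous (fun x => f x i 0)) -> (forall x, f x != 0) ->
  continuous (fun x => (Num.sqrt (sqnorm (f x)))^-1 *: f x).
Proof.
move=> cf f0; apply: matrix_continuous => i j; rewrite (ord1 j).
have -> : (fun x => ((Num.sqrt (sqnorm (f x)))^-1 *: f x) i 0) =
    (fun x => (Num.sqrt (sqnorm (f x)))^-1 * f x i 0).
  by apply/funext => x; rewrite mxE.
move=> x; apply: cvgM; last exact: cf.
apply: cvgV; first by rewrite gt_eqF// sqrtr_gt0 sqnorm_gt0.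
apply: (@continuous_comp _ _ _ (fun x => sqnorm (f x)) Num.sqrt); last exact: sqrt_continuous.
by apply: cvgD; apply: cvgM; exact: cf.
Qed.

(** On the unit circle, the transformation lifts to v |-> M v / |M v|. *)
Lemma mobius_continuous (M : 'M[R]_2) : \det M = 1 -> continuous (mobius M).
Proof.
move=> M1.
pose w (v : @S1 R) : 'cV[R]_2 := M *m val v.
pose h (v : @S1 R) : @S1 R :=
  insubd (Sub (ebase R) (ebase_S1 R) : @S1 R) ((Num.sqrt (sqnorm (w v)))^-1 *: w v).
have v0 (v : @S1 R) : val v != 0.
  apply/eqP => v0; have /set_mem : val v \in @S1 R by exact: (valP v).
  rewrite v0 /S1/= /sqnorm !mxE.
  by rewrite expr0n addr0 => /eqP; rewrite eq_sym oner_eq0.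
have sw0 v : 0 < sqnorm (w v) by apply: sqnorm_gt0; exact: mulmx_neq0.
have valh v : val (h v) = (Num.sqrt (sqnorm (w v)))^-1 *: w v.
  rewrite val_insubd ifT// inE /S1/=; apply: sqnorm_normalize.
  exact: mulmx_neq0.
have cval i : continuous (fun v : @S1 R => val v i 0).
  move=> v; apply: (@continuous_comp _ _ _ (set_val : @S1 R -> _) (fun u : 'cV[R]_2 => u i 0)).
    exact: initial_continuous.
  exact: coord_continuous.
have ch : continuous h.
  apply: continuous_comp_initial.
  have -> : set_val \o h = fun v => (Num.sqrt (sqnorm (w v)))^-1 *: w v.
    by apply/funext => v; rewrite -valh.
  apply: normalize_continuous => [|v]; last exact: mulmx_neq0.
  exact: (mulmx_continuous cval).
apply/(@quotient_continuous _ (P1 R) (P1 R)).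
have -> : mobius M \o \pi_(P1 R) = \pi_(P1 R) \o h.
  apply/funext => v /=.
  have -> : \pi_(P1 R) v = line (val v).
    have : antipodal (repr (\pi_(P1 R) v)) v by have /eqmodP := reprK (\pi_(P1 R) v).
    have := line_unit_vec (\pi_(P1 R) v); rewrite /antipodal -/(unit_vec _) => + uv.
    move=> <-; apply: eq_line => //; first exact: unit_vec_neq0.
    case/orP: uv => /eqP->; first exact: crossvv.
    by rewrite -scaleN1r crossZl crossvv mulr0.
  by rewrite mobius_line// /line.
move=> v; apply: continuous_comp; first exact: ch.
exact: (@pi_continuous _ (P1 R)).
Qed.

End MobiusContinuous.

(** * Germs at infinity of the elements of H(A) *)

Section MonodGerms.
Variables (R : realType) (A : subringClosed R).
Implicit Types (g h : monod_p A) (s c x y : R).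

(** The arcs of any subdivision valid for the identity also serve for a global
projective transformation. *)
Lemma mobius_monod (M : 'M[R]_2) : SL2 A M -> M 1 0 = 0 ->
  exists g : monod_p A, forall p, val g p = mobius M p.
Proof.
move=> MS M10.
pose f := Homeo (mobiusK MS) (mobiusVK MS) (mobius_continuous MS.2)
  (mobius_continuous (SL2_V MS).2).
suff fA : f \in monod_pred A by exists (Sub f fA : monod A).
apply/monod_predP; split=> /=.
  rewrite mobius_line ?ebase_neq0 ?MS.2//; apply: eq_line.
  - by apply: mulmx_neq0; [exact: MS.2|exact: ebase_neq0].
  - exact: ebase_neq0.
  - by rewrite /cross !mxE !sum2 !mxE/= M10; ring.
have [arcs [arcsP arcs_cov]] := piecewise_PSL2_id A.
exists arcs; split=> // ab /arcsP[aH bH _]; split=> //.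
by exists M.
Qed.

Lemma monod_translation c : c \in A ->
  exists g : monod_p A, forall x, val g (affine_pt x) = affine_pt (x + c).
Proof.
move=> cA; pose M : 'M[R]_2 := \matrix_(i, j)
  (if i == 0 then if j == 0 then 1 else c else if j == 0 then 0 else 1).
have MS : SL2 A M.
  split; last by rewrite det22 !mxE/=; ring.
  by apply/mxOverP => i j; rewrite mxE; do 2 case: ifP => _; rewrite ?rpred0 ?rpred1.
have M10 : M 1 0 = 0 by rewrite mxE.
have [g gE] := mobius_monod MS M10; exists g => x.
rewrite gE mobius_affine ?MS.2// !mxE/=; congr affine_pt; ring.
Qed.

(** Only one side of infinity is considered: when infinity is an endpoint of two
pieces, the germs at +oo and at -oo may be different affine maps. *)
Definition germ_at_infty g s c : Prop :=
  \forall x \near +oo, val g (affine_pt x) = affine_pt (s * x + c).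

(** A matrix (a b; 0 d) with a d = 1 acts by x |-> a^2 x + a b.  The intercept
divided by the slope is b / a = b d, which lies in A. *)
Lemma monod_germ g : exists s c, [/\ 0 < s, c / s \in A & germ_at_infty g s c].
Proof.
have /monod_predP[g_infty [arcs [arcsP arcs_cov]]] := valP g.
have [ab abs [ab_infty ab_near]] := cyc_itv_cover_near_infty arcs_cov.
have [_ _ [M MS gM]] := arcsP _ abs.
have M10 : M 1 0 = 0 by apply: mobius_infty; [exact: MS.2|rewrite -gM].
have Mad : M 0 0 * M 1 1 = 1.
  by have := MS.2; rewrite det22 M10 mulr0 subr0.
have M00 : M 0 0 != 0.
  by apply/eqP => M00; move/eqP: Mad; rewrite M00 mul0r eq_sym oner_eq0.
exists (M 0 0 ^+ 2), (M 0 0 * M 0 1); split.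
- by rewrite lt_def sqr_ge0 sqrf_eq0 M00.
- have -> : M 0 0 * M 0 1 / M 0 0 ^+ 2 = M 0 1 * M 1 1.
    have -> : M 1 1 = (M 0 0)^-1 by rewrite -[RHS]mulr1 -Mad mulKf.
    by field.
  by rewrite rpredM//; exact: (mxOverP MS.1).
- by apply: filterS ab_near => x /gM ->; rewrite mobius_affine// MS.2.
Qed.

Lemma germ_unique g s c s' c' :
  germ_at_infty g s c -> germ_at_infty g s' c' -> s = s' /\ c = c'.
Proof.
move=> gs gs'.
have : \forall x \near +oo, s * x + c = s' * x + c'.
  by apply: filterS2 gs gs' => x -> /affine_pt_inj.
move=> [N [_ Neq]].
have E1 := Neq (N + 1) ltac:(by rewrite /= ltrDl).
have E2 := Neq (N + 2) ltac:(by rewrite /= ltrDl).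
have ss' : s = s' by lra.
by split=> //; move: E1; rewrite ss' => /addrI.
Qed.

Lemma germM g h s c s' c' : 0 < s' ->
  germ_at_infty g s c -> germ_at_infty h s' c' ->
  germ_at_infty (g * h)%g (s * s') (s * c' + c).
Proof.
move=> s'0 [N [_ gN]] hs'.
have : \forall x \near +oo, N < s' * x + c'.
  near=> x; rewrite -ltrBlDr mulrC -ltr_pdivrMr//.
  by near: x; apply: nbhs_pinfty_gt; exact: num_real.
apply: filterS2 hs' => x hx Nx.
change (val g (val h (affine_pt x)) = affine_pt (s * s' * x + (s * c' + c))).
by rewrite hx gN//; congr affine_pt; ring.
Unshelve. all: by end_near. Qed.

End MonodGerms.

(** * The invariant mean *)

Section Functionals.
Variables (R : realType) (G : topologicalGroupType).

Lemma LUCB_bounded (f : LUCB R G) : bounded_function (f : G -> R).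
Proof. by have /lucbP[] := valP f. Qed.

Lemma skew_amenable_functional (phi : LUCB R G -> R) :
  (forall a f g, phi (a *: f + g) = a * phi f + phi g) ->
  (forall f : LUCB R G, (forall x, 0 <= f x) -> 0 <= phi f) ->
  phi (LUCB_one R G) = 1 ->
  (forall f g, phi (LUCB_lmul g f) = phi f) ->
  skew_amenable R G.
Proof.
move=> phi_lin phi_ge0 phi1 phiG.
pose mu : {scalar LUCB R G} :=
  HB.pack phi (GRing.isLinear.Build R (LUCB R G) R *%R phi phi_lin).
by exists mu.
Qed.

End Functionals.

Section MonodMean.
Variables (R : realType) (A : subringClosed R).
Implicit Types (g h : monod_p A) (s c x y : R).

Lemma monod_fix_infty g : val g (infty R) = infty R.
Proof. by have /monod_predP[] := valP g. Qed.

Lemma germ_slope g s c : germ_at_infty g s c -> 0 < s /\ c / s \in A.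
Proof.
by have [s' [c' [s'0 c'A gs']]] := monod_germ g; move/(germ_unique gs') => [<- <-].
Qed.

(** Left-uniform continuity for the topology of pointwise convergence: two
arguments that agree on a suitable finite set have close images. *)
Lemma lucb_near_eq (f : LUCB R (monod_p A)) (T : Type) (F : set_system T)
    (k k' : T -> monod_p A) : Filter F ->
  (forall p, \forall t \near F, val (k t) p = val (k' t) p) ->
  forall e, 0 < e -> \forall t \near F, `|f (k t) - f (k' t)| <= e.
Proof.
move=> FF kk' e e0; have /lucbP[_ /(_ e e0)[U U1 fU]] := valP f.
have [s sU] := (monod_p_nbhsP _ _).1 U1.
have : \forall t \near F, forall p, p \in s -> val (k t) p = val (k' t) p.
  elim: s {sU} => [|p s IHs]; first exact: nearW.
  apply: filterS2 (kk' p) IHs => t kp ks q.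
  by rewrite inE => /predU1P[->|/ks].
apply: filterS => t kk't; apply: fU; apply: sU => p ps.
change (homeo_inv (val (k t)) (val (k' t) p) = p).
by rewrite -kk't// homeoK.
Qed.

Definition ring_pinfty : set_system R := within [set c | c \in A] (pinfty_nbhs R).

Global Instance ring_pinfty_proper : ProperFilter ring_pinfty.
Proof.
apply: Build_ProperFilter_ex => P [N [_ NP]].
exists (Num.truncn N).+1%:R; apply: NP; last by rewrite /= rpred_nat.
exact: truncnS_gt.
Qed.

Lemma ring_pinfty_shift y (P : set R) :
  (\forall x \near +oo, P x) -> \forall c \near ring_pinfty, P (c + y).
Proof.
move=> [N [_ NP]]; exists (N - y); split; first exact: num_real.
by move=> c /=; rewrite ltrBlDr => Nc _; exact: NP.
Qed.

Lemma ring_pinftyW (P : set R) :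
  (forall c, c \in A -> P c) -> \forall c \near ring_pinfty, P c.
Proof. by move=> AP; rewrite /ring_pinfty near_withinE; apply: nearW. Qed.

Lemma ring_pinfty_translate y : y \in A -> c + y @[c --> ring_pinfty] --> ring_pinfty.
Proof.
move=> yA P /(ring_pinfty_shift y) Py.
apply: filterS2 (ring_pinftyW (fun c cA => cA)) Py => c cA; apply.
by rewrite /= rpredD.
Qed.

Section Averages.
Variables (tr : R -> monod_p A) (m : (R -> R) -> R).
Hypothesis trP : forall c, c \in A -> forall x,
  val (tr c) (affine_pt x) = affine_pt (x + c).
Hypothesis mF : filter_mean ring_pinfty m.
Hypothesis m_inv : forall b, b \in A -> forall f, bounded_function f ->
  m (fun c => f (c + b)) = m f.

(** Let b = (c - d) / s, an element of A, and let t_a be the translation by a.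
Any given real point has the same image under g t_a and h t_(a + b) once a is
large, and translating the variable of the mean by b does not change it. *)
Lemma mean_germ_slope (f : LUCB R (monod_p A)) g h s c d :
  germ_at_infty g s c -> germ_at_infty h s d ->
  m (fun t => f (g * tr t)%g) = m (fun t => f (h * tr t)%g).
Proof.
move=> gs hs; have [s0 cA] := germ_slope gs; have [_ dA] := germ_slope hs.
pose b := (c - d) / s; have bA : b \in A by rewrite /b mulrBl rpredB.
have bf := LUCB_bounded f.
rewrite -(m_inv bA (f := fun t => f (h * tr t)%g)); last exact: bounded_function_comp bf.
apply: (filter_mean_eq mF); [exact: bounded_function_comp bf..|].
apply: lucb_near_eq => p; have [->|[z ->]] := P1_cases p.
  by apply: nearW => t; rewrite !monod_fix_infty.
have := ring_pinftyW (fun t (tA : t \in A) => tA).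
apply: filterS3 (ring_pinfty_shift z gs) (ring_pinfty_shift (b + z) hs) => t gt ht tA.
change (val g (val (tr t) (affine_pt z)) = val h (val (tr (t + b)) (affine_pt z))).
rewrite !trP ?rpredD//.
rewrite [z + t]addrC gt [z + _]addrC -addrA ht; congr affine_pt.
by rewrite /b; field; rewrite gt_eqF.
Qed.

End Averages.

End MonodMean.

Theorem corollary8p3 (R : realType) (A : subringClosed R) :
  skew_amenable R (monod_p A).
Proof.
have [tr trP] : exists tr : R -> monod_p A, forall c, c \in A -> forall x,
    val (tr c) (affine_pt x) = affine_pt (x + c).
  suff tr_ex c : exists g : monod_p A, c \in A -> forall x,
      val g (affine_pt x) = affine_pt (x + c) by have [tr trP] := choice tr_ex; exists tr.
  have [cA|cA] := boolP (c \in A); last by exists 1%g.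
  by have [g gP] := monod_translation cA; exists g.
have [m mF m_inv] : exists2 m, filter_mean (ring_pinfty A) m &
    forall b, b \in A -> forall f : R -> R, bounded_function f ->
      m (fun c => f (c + b)) = m f.
  pose T (b : {b : R | b \in A}) c := c + val b.
  have TC b c x : T b (T c x) = T c (T b x) by rewrite /T addrAC.
  have TF b : T b x @[x --> ring_pinfty A] --> ring_pinfty A.
    by apply: ring_pinfty_translate; exact: valP.
  have [m mF m_inv] := invariant_filter_mean R (ring_pinfty_proper A) TC TF.
  by exists m => // b bA; exact: (m_inv (exist _ b bA)).
pose slopes : set R := [set s | exists g : monod_p A, exists c, germ_at_infty g s c].
have [lift liftP] : exists lift : R -> monod_p A, forall s, slopes s ->
    exists c, germ_at_infty (lift s) s c.
  suff lift_ex s : exists g : monod_p A, slopes s -> exists c, germ_at_infty g s c.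
    by have [lift liftP] := choice lift_ex; exists lift.
  by have [[g gs]|] := pselect (slopes s); [exists g|exists 1%g].
have [slope slopeP] : exists slope : monod_p A -> R,
    forall g, exists c, germ_at_infty g (slope g) c.
  suff slope_ex (g : monod_p A) : exists s c, germ_at_infty g s c.
    by have [slope slopeP] := choice slope_ex; exists slope.
  by have [s [c [_ _ gs]]] := monod_germ g; exists s, c.
have slopesM (g : monod_p A) s : slopes s -> exists c,
    germ_at_infty (g * lift s)%g (slope g * s) c.
  move=> /liftP[c sc]; have [d gd] := slopeP g; have [s0 _] := germ_slope sc.
  by exists (slope g * c + d); exact: germM.
have slopes_proper : ProperFilter (globally slopes).
  apply: (@globally_properfilter _ _ (slope 1%g)).
  by exists 1%g; exact: slopeP.
have slopeC (g h : monod_p A) s : slope g * (slope h * s) = slope h * (slope g * s) by rewrite mulrCA.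
have slopeF (g : monod_p A) : slope g * s @[s --> globally slopes] --> globally slopes.
  move=> P SP s Ss; apply: SP; have [c gc] := slopesM g s Ss.
  by exists (g * lift s)%g, c.
have [n nF n_inv] := invariant_filter_mean R slopes_proper slopeC slopeF.
(* By mean_germ_slope, psi f g depends only on the slope of g at +oo. *)
pose psi (f : LUCB R (monod_p A)) g := m (fun c => f (g * tr c)%g).
have bf (f : LUCB R (monod_p A)) (g : monod_p A) :
    bounded_function (fun c => f (g * tr c)%g).
  exact: bounded_function_comp (LUCB_bounded f).
have bpsi (f : LUCB R (monod_p A)) : bounded_function (fun s => psi f (lift s)).
  have [M fM] := LUCB_bounded f; exists M => s; apply: (filter_mean_norm_le mF) => //.
  exact: nearW.
apply: (@skew_amenable_functional _ _ (fun f => n (fun s => psi f (lift s)))).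
- move=> a f g; rewrite -nF.1//; congr n; apply/funext => s.
  by rewrite /psi -mF.1.
- move=> f f0; apply: (filter_mean_ge nF) => //; apply: nearW => s.
  by apply: (filter_mean_ge mF) => //; exact: nearW.
- rewrite -[RHS](filter_mean1 nF); congr n; apply/funext => s.
  exact: (filter_mean1 mF).
- move=> f g; rewrite -(n_inv g (fun s => psi f (lift s)))//.
  apply: (filter_mean_eq nF) => //; first exact: bounded_function_comp (bpsi f).
  move=> e e0 s Ss.
  have [c gc] := slopesM g s Ss.
  have [d gd] : exists d, germ_at_infty (lift (slope g * s)) (slope g * s) d.
    by apply: liftP; exists (g * lift s)%g, c.
  rewrite (_ : psi _ _ = psi f (lift (slope g * s))) ?subrr ?normr0 ?ltW//.
  rewrite -[RHS](mean_germ_slope trP mF m_inv f gc gd) /psi; congr m.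
  by apply/funext => t; rewrite -mulgA.
Qed.
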